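(* Let $r>0$ and let $n,p$ be positive integers. Assume that $\gamma\log p<n$ for some constant $\gamma>8$ and fix $C_0\ge 4$. Consider the threshold $$\tau=2C_0\sqrt{\frac{\gamma\log p}{n}}$$ and assume that $\tau\le 1$. Then, for any $q\in[0,r)$, any $R>0$ and any $\Sigma\in\mathcal{G}_q(R)$, the plug-in estimator $\ell_r(\tilde\Sigma_\tau)$ satisfies $$\mathbb{E}\Big[\big(\ell_r(\tilde\Sigma_\tau)-\ell_r(\Sigma)\big)^2\Big]\le C_5\,\tilde\psi_{n,p}(q,R)+C_6\,p^{4-\gamma/2},$$ where $$\tilde\psi_{n,p}(q,R)=\begin{cases}\dfrac{R^2\log p}{n}, & \text{if } q<\max\{r-1,0\},\\[2mm] R^2\Big(\dfrac{\gamma\log p}{n}\Big)^{r-q}, & \text{if } q\ge\max\{r-1,0\},\end{cases}$$ and $C_5$ and $C_6$ are positive constants (depending only on $\gamma,C_0,q,r$).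
   Context: $\mathbf{S}_p^+$ is the set of $p\times p$ real symmetric positive semi-definite matrices. For a matrix $A=(a_{ij})$, $\ell_r(A)=\max_{i\le p}\sum_{j\le p}|a_{ij}|^r$. For $q\in[0,r)$ and $R>0$, $$\mathcal{G}_q(R)=\Big\{\Sigma=(\sigma_{ij})\in\mathbf{S}_p^+:\ \max_{i\le p}\sum_{j\le p}|\sigma_{ij}|^q\le R,\ \mathrm{diag}(\Sigma)=I_p\Big\},$$ where $\mathrm{diag}(\Sigma)$ is $\Sigma$ with off-diagonal entries set to $0$, and for $q=0$, $|x|^0$ means $1$ if $x\ne0$ and $0$ if $x=0$. The observations $X_1,\dots,X_n$ are i.i.d. $\mathcal{N}(0,\Sigma)$ in $\mathbb{R}^p$, and $\mathbb{E}$ is expectation under this law. The empirical covariance matrix is $\hat\Sigma=\frac1n\sum_{k=1}^nX_kX_k^\top=(\hat\sigma_{ij})$. The thresholded matrix $\tilde\Sigma_\tau=(\tilde\sigma_{ij})$ is defined by $\tilde\sigma_{ij}=\hat\sigma_{ij}\mathbf{1}\{|\hat\sigma_{ij}|>\tau\}$ for $i\ne j$ and $\tilde\sigma_{ii}=\hat\sigma_{ii}$. *)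

(* Defs.v *)
From HB Require Import structures.
From mathcomp Require Import all_boot all_order all_algebra.
From mathcomp Require Import all_classical all_reals all_analysis.

Set Implicit Arguments.
Unset Strict Implicit.
Unset Printing Implicit Defensive.

Import Order.TTheory GRing.Theory Num.Theory.
Import numFieldNormedType.Exports.

Local Open Scope classical_set_scope.
Local Open Scope ring_scope.

Section matrices.
Context {R : realType}.

Definition psd_mx (p : nat) (A : 'M[R]_p) : Prop :=
  A^T = A /\ forall x : 'cV[R]_p, 0 <= (x^T *m A *m x) 0 0.

(* The library has 0 `^ 0 = 1, whereas sparsity classes use |0|^0 = 0. *)
Definition abs_pow (x q : R) : R :=
  if q == 0 then (x != 0)%:R else `|x| `^ q.

(* The row sums are nonnegative, so for 0 < p the base value 0 of the
   iterated maximum is immaterial. *)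
Definition ell (r : R) (p : nat) (A : 'M[R]_p) : R :=
  \big[Num.max/0]_(i < p) \sum_(j < p) abs_pow (A i j) r.

Definition diag_part (p : nat) (A : 'M[R]_p) : 'M[R]_p :=
  \matrix_(i, j) if i == j then A i j else 0.

Definition sparse_class (q M : R) (p : nat) : set 'M[R]_p :=
  [set S | [/\ psd_mx S, ell q S <= M & diag_part S = 1%:M]].

Definition threshold_mx (tau : R) (p : nat) (A : 'M[R]_p) : 'M[R]_p :=
  \matrix_(i, j) if (i == j) || (tau < `|A i j|) then A i j else 0.

(* Vectors of R^p are p-tuples because it is tuples that carry the product
   sigma-algebra. *)
Definition cv_of_tuple (p : nat) (x : p.-tuple R) : 'cV[R]_p :=
  \col_i tnth x i.

Definition empirical_cov (n p : nat) (x : 'I_n -> p.-tuple R) : 'M[R]_p :=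
  n%:R^-1 *: \sum_(k < n) (cv_of_tuple (x k) *m (cv_of_tuple (x k))^T).

Definition tau_threshold (C0 gamma : R) (n p : nat) : R :=
  2 * C0 * Num.sqrt (gamma * ln p%:R / n%:R).

Definition rate (gamma r q M : R) (n p : nat) : R :=
  if q < Num.max (r - 1) 0 then M ^+ 2 * ln p%:R / n%:R
  else M ^+ 2 * (gamma * ln p%:R / n%:R) `^ (r - q).

End matrices.

Section gaussian_sample.
Context {R : realType}.

(* N(0, v) on the real line, parameterized by its variance v >= 0. The
   degenerate case is split off because [normal_prob m 0] is the uniform
   law on [0, 1]. *)
Definition centered_normal (v : R) : set R -> \bar R :=
  if v == 0 then \d_(0 : R) else normal_prob 0 (Num.sqrt v).

(* mu is the law N(0, S) on R^p, with S possibly singular: every linear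
   form u has law N(0, u^T S u) under mu. *)
Definition centered_gaussian (p : nat) (S : 'M[R]_p)
    (mu : set (p.-tuple R) -> \bar R) : Prop :=
  forall (u : 'cV[R]_p) (A : set R), measurable A ->
    mu [set x | A ((u^T *m cv_of_tuple x) 0 0)] =
    centered_normal ((u^T *m S *m u) 0 0) A.

Definition mutually_independent (d d' : measure_display)
    (T : measurableType d) (T' : measurableType d') (P : probability T R)
    (n : nat) (X : 'I_n -> {RV P >-> T'}) : Prop :=
  forall (J : {set 'I_n}) (A : 'I_n -> set T'),
    (forall k, measurable (A k)) ->
    P (\bigcap_(k in [set` J]) (X k @^-1` A k)) =
    (\prod_(k in J) P (X k @^-1` A k))%E.

Definition iid_centered_gaussian (d : measure_display) (T : measurableType d)
    (P : probability T R) (n p : nat) (S : 'M[R]_p)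
    (X : 'I_n -> {RV P >-> p.-tuple R}) : Prop :=
  mutually_independent X /\
  forall k, centered_gaussian S (distribution P (X k)).

End gaussian_sample.

(* Main.v *)
(** By polarization, the entry (i, j) of the empirical covariance matrix is
    (Q_+ - Q_-) / 4, where Q_+ and Q_- are the empirical mean squares of the
    Gaussian linear forms x_i + x_j and x_i - x_j, whose variances are at most
    4.  When all of them are within 3 tau / 2 of these variances, every
    empirical entry is within 3 tau / 4 of its target s, and the thresholded
    entry then changes |s|^r by at most a constant times |s|^q times the square
    root of the rate; summing over a row gives the first term of the bound.
    Otherwise, the error Z satisfies Z^2 <= Z^4 / (2 K) + K / 2; here Z^4 is at
    most p^4 times a sum of exponentials of small multiples of the mean
    squares, and K / 2 is at most K / 2 times a sum of Chernoff exponentials.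
    The expectations of all these exponentials are controlled by the inequality
    E exp(l (Y^2 - v)) <= exp(2 l^2 v^2) for Y ~ N(0, v) and |l| v small, and
    K = p^(2 + gamma / 2) makes both contributions O(p^(4 - gamma / 2)). *)

Require Import Defs.
From HB Require Import structures.
From mathcomp Require Import all_boot all_order all_algebra.
From mathcomp Require Import all_classical all_reals all_analysis.
From mathcomp Require Import finmap measurable_realfun ring lra.

Set Implicit Arguments.
Unset Strict Implicit.
Unset Printing Implicit Defensive.

Import Order.TTheory GRing.Theory Num.Theory.
Import numFieldNormedType.Exports.

Local Open Scope classical_set_scope.
Local Open Scope ring_scope.

(** * Expectation of a product of functions of independent variables *)

Section simple_functions.
Import HBNNSimple.

(** Indexing the values by ['I_N] lets a product over k of such sums be expanded over the finite
    functions from ['I_n] to ['I_N]. *)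
Lemma nnsfun_sum_indic {R : realType} d (T : measurableType d)
    (g : {nnsfun T >-> R}) :
  exists (N : nat) (a : 'I_N -> R) (B : 'I_N -> set T),
    [/\ forall i, measurable (B i), forall i, 0 <= a i &
        forall y, g y = \sum_(i < N) a i * \1_(B i) y].
Proof.
pose s := fset_set (g @` setT); pose N := #|`s|.
exists N, (fun i => s`_i), (fun i => g @^-1` [set s`_i]); split => [i|i|y].
- exact: measurable_sfunP.
- have : s`_i \in s by rewrite mem_nth.
  by rewrite in_fset_set// => /set_mem[y _ <-].
- exact: fimfunEord.
Qed.

End simple_functions.

Section independence.
Context {R : realType} d d' (T : measurableType d) (T' : measurableType d').
Variables (P : probability T R) (n : nat) (X : 'I_n -> {RV P >-> T'}).
Hypothesis indepX : mutually_independent X.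
Local Open Scope ereal_scope.
Import HBNNSimple.

(** The product of sums of indicators expands into indicators of joint events; independence factors
    their probabilities, and the sum is folded back. *)
Lemma expectation_prod_nnsfun (g : {nnsfun T' >-> R}) :
  \int[P]_w (\prod_k g (X k w))%:E = \prod_k \int[P]_w (g (X k w))%:E.
Proof.
have [N [a [B [mB a0 gE]]]] := nnsfun_sum_indic g.
have mXB k i : measurable (X k @^-1` B i).
  by rewrite -[_ @^-1` _]setTI; exact: measurable_funP.
have PE A : measurable A -> P A = (fine (P A))%:E.
  by move=> mA; rewrite fineK// fin_num_measure.
have -> : \prod_k \int[P]_w (g (X k w))%:E =
    (\prod_k \sum_(i < N) a i * fine (P (X k @^-1` B i)))%:E.
  rewrite -prodEFin; apply: eq_bigr => k _.
  under eq_integral do rewrite gE -sumEFin.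
  rewrite ge0_integral_sum//=.
  - rewrite -sumEFin; apply: eq_bigr => i _.
    under eq_integral do rewrite EFinM.
    rewrite ge0_integralZl//=.
    + rewrite (@integral_indic _ _ _ P setT measurableT (X k @^-1` B i))//.
      by rewrite setIT EFinM -PE.
    + apply/measurable_EFinP; exact: (@measurable_indic _ _ _ setT (X k @^-1` B i)).
    + by rewrite lee_fin; exact: a0.
  - move=> i; apply/measurable_EFinP; apply: measurable_funM => //.
    exact: (@measurable_indic _ _ _ setT (X k @^-1` B i)).
  - by move=> i w _; rewrite lee_fin mulr_ge0.
(* [phi] chooses one set [B i] for each k; the product of the chosen indicators is the indicator of
   the joint event. *)
pose E (phi : {ffun 'I_n -> 'I_N}) :=
  \bigcap_(k in [set` [set: 'I_n]%SET]) (X k @^-1` B (phi k)).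
have mE phi : measurable (E phi).
  by apply: fin_bigcap_measurable => //; exact: finite_finset.
have prodE w : (\prod_k g (X k w) =
    \sum_(phi : {ffun 'I_n -> 'I_N}) (\prod_k a (phi k)) * \1_(E phi) w)%R.
  under eq_bigr do rewrite gE.
  rewrite bigA_distr_bigA/=; apply: eq_bigr => phi _.
  rewrite big_split/=; congr (_ * _)%R.
  rewrite indicE; case: (boolP (w \in E phi)) => /= [/set_mem Ew|nE].
    rewrite big1// => k _; rewrite indicE mem_set//.
    by apply: Ew => /=; rewrite finset.in_setT.
  have [k nB] : exists k, ~ B (phi k) (X k w).
    apply/existsNP => h; move/negP: nE; apply; apply/mem_set => k _; exact: h.
  by rewrite (bigD1 k)//= indicE memNset// mul0r.
under eq_integral do rewrite prodE -sumEFin.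
rewrite ge0_integral_sum//=.
- rewrite bigA_distr_bigA/= -sumEFin; apply: eq_bigr => phi _.
  under eq_integral do rewrite EFinM.
  rewrite ge0_integralZl//=.
  + rewrite integral_indic// setIT big_split/= EFinM; congr (_ * _).
    rewrite -prodEFin.
    transitivity (\prod_(k in [set: 'I_n]%SET) P (X k @^-1` B (phi k))).
      exact: (indepX [set: 'I_n]%SET (fun k => mB (phi k))).
    by apply: eq_big => [k|k _]; rewrite ?finset.in_setT// -PE.
  + exact/measurable_EFinP/measurable_indic.
  + by rewrite lee_fin prodr_ge0.
- by move=> i; exact/measurable_EFinP/measurable_funM.
- by move=> i w _; rewrite lee_fin mulr_ge0// prodr_ge0.
Qed.

(** Monotone convergence on the left reduces the claim to simple approximations of [f], whose
    products factor, each factor being at most the integral of [f]. An upper bound is all that a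
    Chernoff argument requires, and it avoids a limit in a product of possibly infinite
    integrals. *)
Lemma expectation_prod_le (f : T' -> R) :
    measurable_fun setT f -> (forall y, (0 <= f y)%R) ->
  \int[P]_w (\prod_k f (X k w))%:E <= \prod_k \int[P]_w (f (X k w))%:E.
Proof.
move=> mf f0.
have mEf : measurable_fun setT (EFin \o f) by exact/measurable_EFinP.
pose g := nnsfun_approx measurableT mEf.
have ndg (y : T') : {homo (fun N => g N y) : N M / (N <= M)%N >-> (N <= M)%R}.
  by move=> N M NM; have /lefP := nd_nnsfun_approx measurableT mEf NM; exact.
have cg (y : T') : (g N y : R^o) @[N --> \oo] --> f y.
  have := cvg_nnsfun_approx measurableT mEf (fun x _ => f0 x) (I : setT y).
  by move/fine_cvgP => [].
pose h N w := (\prod_k g N (X k w))%:E.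
have mh N : measurable_fun setT (h N).
  apply/measurable_EFinP; apply: measurable_prod => k _.
  by apply: (measurableT_comp (f := g N)).
have h0 N w : 0 <= h N w by rewrite /h lee_fin prodr_ge0.
have ndh w : {homo (h ^~ w) : N M / (N <= M)%N >-> N <= M}.
  move=> N M NM; rewrite lee_fin; apply: ler_prod => k _.
  by rewrite fun_ge0/= ndg.
have ch w : h N w @[N --> \oo] --> (\prod_k f (X k w))%:E.
  apply: cvg_EFin; first by exact: nearW.
  have := @cvg_big R^o 'I_n *%R 1%R xpredT (@mul_continuous R) nat \oo
    (index_enum 'I_n) (fun k N => g N (X k w)) (fun k => f (X k w)) _
    (fun k _ => cg (X k w)).
  exact.
have -> : \int[P]_w (\prod_k f (X k w))%:E = limn (fun N => \int[P]_w h N w).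
  rewrite -monotone_convergence//.
  by apply: eq_integral => w _; apply/esym/cvg_lim.
apply: lime_le.
  apply: ereal_nondecreasing_is_cvgn => N M NM; apply: ge0_le_integral => //.
  by move=> w _; exact: ndh.
apply: nearW => N; rewrite /h expectation_prod_nnsfun.
have le_int k : \int[P]_w (g N (X k w))%:E <= \int[P]_w (f (X k w))%:E.
  apply: ge0_le_integral => //.
  - by move=> w _; rewrite lee_fin.
  - by apply/measurable_EFinP; apply: (measurableT_comp (f := g N)).
  - by apply/measurable_EFinP; apply: (measurableT_comp (f := f)).
  - move=> w _; rewrite lee_fin.
    rewrite -(cvg_lim (@Rhausdorff R) (cg (X k w))).
    apply: nondecreasing_cvgn_le; last by apply/cvg_ex; exists (f (X k w)); exact: cg.
    by move=> ? ? ?; exact: ndg.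
have ge0 k : 0 <= \int[P]_w (g N (X k w))%:E.
  by apply: integral_ge0 => w _; rewrite lee_fin.
(* Nonnegativity is carried through the induction because multiplication is monotone only on
   nonnegative factors. *)
suff : 0 <= \prod_k \int[P]_w (g N (X k w))%:E <= \prod_k \int[P]_w (f (X k w))%:E.
  by case/andP.
elim/big_rec2 : _ => [|k x y _ /andP[x0 xy]]; first by rewrite lexx lee_fin ler01.
by rewrite mule_ge0//= lee_pmul.
Qed.
End independence.

(** * The moment generating function of a squared centered normal variable *)

Section density.
Context {R : realType} d (T : measurableType d).
Variables (mu nu : {measure set T -> \bar R}) (p : T -> R).
Hypotheses (mp : measurable_fun setT p) (p0 : forall x, 0 <= p x).
Hypothesis nuE : forall A, measurable A -> nu A = (\int[mu]_(x in A) (p x)%:E)%E.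
Local Open Scope ereal_scope.
Import HBNNSimple.

Lemma integral_density_nnsfun (g : {nnsfun T >-> R}) :
  \int[nu]_x (g x)%:E = \int[mu]_x (g x * p x)%:E.
Proof.
have [N [a [B [mB a0 gE]]]] := nnsfun_sum_indic g.
under eq_integral do rewrite gE -sumEFin.
rewrite ge0_integral_sum//=; last 2 first.
- by move=> i; exact/measurable_EFinP/measurable_funM.
- by move=> i w _; rewrite lee_fin mulr_ge0.
under [RHS]eq_integral do rewrite gE mulr_suml -sumEFin.
rewrite ge0_integral_sum//=; last 2 first.
- move=> i; apply/measurable_EFinP; do 2 apply: measurable_funM => //.
- by move=> i w _; rewrite lee_fin !mulr_ge0.
apply: eq_bigr => i _.
under eq_integral do rewrite EFinM.
rewrite ge0_integralZl//=; last 2 first.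
- exact/measurable_EFinP/measurable_indic.
- by rewrite lee_fin; exact: a0.
under [RHS]eq_integral do rewrite -mulrA EFinM.
rewrite ge0_integralZl//=; last 3 first.
- by apply/measurable_EFinP; apply: measurable_funM => //; exact: measurable_indic.
- by move=> x _; rewrite lee_fin mulr_ge0.
- by rewrite lee_fin; exact: a0.
congr (_ * _); rewrite integral_indic// setIT nuE// integral_mkcond.
apply: eq_integral => x _; rewrite patchE indicE.
by case: (x \in B i); rewrite ?mul1r ?mul0r.
Qed.

(** Monotone convergence applies on both sides, since multiplying by [p x >= 0] keeps the simple
    approximations increasing. *)
Lemma ge0_integral_density (f : T -> R) :
    measurable_fun setT f -> (forall x, (0 <= f x)%R) ->
  \int[nu]_x (f x)%:E = \int[mu]_x (f x * p x)%:E.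
Proof.
move=> mf f0.
have mEf : measurable_fun setT (EFin \o f) by exact/measurable_EFinP.
pose g := nnsfun_approx measurableT mEf.
have ndg x : {homo (fun N => g N x) : N M / (N <= M)%N >-> (N <= M)%R}.
  by move=> N M NM; have /lefP := nd_nnsfun_approx measurableT mEf NM; exact.
have cg x := cvg_nnsfun_approx measurableT mEf (fun x _ => f0 x) (I : setT x).
transitivity (limn (fun N => \int[nu]_x (g N x)%:E)).
  rewrite -monotone_convergence//.
  - by apply: eq_integral => x _; apply/esym/cvg_lim => //; exact: cg.
  - by move=> N; exact/measurable_EFinP.
  - by move=> N x _; rewrite lee_fin.
  - by move=> x _ N M NM; rewrite lee_fin; exact: ndg.
under eq_fun do rewrite integral_density_nnsfun.
rewrite -monotone_convergence//.
- apply: eq_integral => x _; apply/cvg_lim => //.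
  rewrite [X in _ --> X]EFinM; under eq_cvg do rewrite EFinM.
  have pfin : (p x)%:E \is a fin_num by [].
  exact: cvgeZr pfin (cg x).
- by move=> N; apply/measurable_EFinP; exact: measurable_funM.
- by move=> N x _; rewrite lee_fin mulr_ge0.
- by move=> x _ N M NM; rewrite lee_fin ler_wpM2r//; exact: ndg.
Qed.
End density.

Section normal_square.
Context {R : realType}.

(* With x = 2 l v, this turns the exact value exp(- l v) / sqrt(1 - 2 l v) of
   E exp(l (Y^2 - v)) into the bound exp(2 l^2 v^2). *)
Lemma expR_quadratic_ge (x : R) : `|x| <= 3 / 16 -> 1 <= expR (x + x ^+ 2) * (1 - x).
Proof.
move=> xs; have [x0|x0] := leP x 0.
  have xge : - (3/16) <= x by move: xs; rewrite ler_norml => /andP[].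
  have e := expR_ge1Dx (x + x ^+ 2).
  have : (1 + (x + x ^+ 2)) * (1 - x) <= expR (x + x ^+ 2) * (1 - x).
    by rewrite ler_wpM2r//; lra.
  apply: le_trans; rewrite -subr_ge0.
  have -> : (1 + (x + x ^+ 2)) * (1 - x) - 1 = x ^+ 2 * (- x) by ring.
  by rewrite mulr_ge0 ?sqr_ge0// oppr_ge0.
have xle : x <= 3/16 by move: xs; rewrite ler_norml => /andP[].
(* For x > 0 the tangent bound on exp(x + x^2) only gives 1 - x^3, below 1. Squaring the tangent
   bound at half the exponent supplies the missing second-order term. *)
pose y := (x + x ^+ 2) / 2.
have y0 : 0 <= y by rewrite /y divr_ge0// addr_ge0 ?sqr_ge0// ltW.
have -> : x + x ^+ 2 = 2%:R * y by rewrite /y; field.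
rewrite expRM_natl.
have e : (1 + y) ^+ 2 <= expR y ^+ 2.
  by rewrite ler_pXn2r ?nnegrE ?expR_ge0 ?expR_ge1Dx// addr_ge0.
have : (1 + y) ^+ 2 * (1 - x) <= expR y ^+ 2 * (1 - x) by rewrite ler_wpM2r//; lra.
apply: le_trans; rewrite -subr_ge0 /y.
have -> : (1 + (x + x ^+ 2) / 2) ^+ 2 * (1 - x) - 1 =
  x ^+ 2 * (4^-1 - 3/4 * x - 4^-1 * x ^+ 2 - 4^-1 * x ^+ 3) by field.
rewrite mulr_ge0 ?sqr_ge0//.
have x2 : x ^+ 2 <= 3/16 * x by rewrite expr2 ler_wpM2r// ltW.
have x3 : x ^+ 3 <= 3/16 * x.
  have : x ^+ 3 <= x ^+ 2 * 1 by rewrite exprSr ler_wpM2l ?sqr_ge0//; lra.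
  lra.
lra.
Qed.

(** Multiplying the N(0, v) density by exp(l y^2) gives, up to a constant, the density of N(0, v /
    (1 - 2 l v)). *)
Lemma tilted_exponent (l v y : R) : 0 < v -> 0 < 1 - 2 * (l * v) ->
  - y ^+ 2 / ((v / (1 - 2 * (l * v))) *+ 2) = l * y ^+ 2 + (- y ^+ 2 / (v *+ 2)).
Proof.
move=> v0 x1.
rewrite -(mulr_natr v) -(mulr_natr (_ / _)); field.
by rewrite !gt_eqF.
Qed.

(* The integral is taken over [measurableTypeR R], where [normal_prob] lives;
   the canonical measurable structure on [R] has the same measurable sets but a
   different display, and does not unify with it. *)
Lemma expectation_normal_square (l v : R) : 0 <= v -> `|l| * v <= 3 / 32 ->
  (@integral _ (measurableTypeR R) R (centered_normal v) setT
     (fun y : R => (expR (l * (y ^+ 2 - v)))%:E) <=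
   (expR (2 * (l * v) ^+ 2))%:E)%E.
Proof.
move=> v0 lv.
have mf : measurable_fun [set: measurableTypeR R]
    (fun y : R => expR (l * (y ^+ 2 - v))).
  apply: measurableT_comp => //; apply: measurable_funM => //.
  by apply: measurable_funB => //; exact: measurable_funX.
(* For v = 0 the law is the Dirac mass at 0 and both sides equal 1. *)
rewrite /centered_normal; case: ifPn => [/eqP v00|vn0].
  rewrite integral_dirac//; last exact/measurable_EFinP.
  by rewrite diracT mul1e v00 expr0n/= subr0 !mulr0 expr0n/= mulr0.
have {v0 vn0} v0 : 0 < v by rewrite lt_neqAle eq_sym vn0.
pose x := 2 * (l * v).
have xs : `|x| <= 3/16.
  by rewrite /x !normrM (ger0_norm (ltW v0)) ger0_norm//; lra.
have x1 : 0 < 1 - x by move: xs; rewrite ler_norml => /andP[]; lra.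
pose w := v / (1 - x).
have w0 : 0 < w by rewrite divr_gt0.
have sv0 : Num.sqrt v != 0 by rewrite gt_eqF// sqrtr_gt0.
have sw0 : Num.sqrt w != 0 by rewrite gt_eqF// sqrtr_gt0.
pose nu : {measure set (measurableTypeR R) -> \bar R} := normal_prob 0 (Num.sqrt v).
have nuE A : measurable A -> nu A =
    (\int[lebesgue_measure]_(x in A) (normal_pdf 0 (Num.sqrt v) x)%:E)%E by [].
rewrite -[X in (X <= _)%E]/(\int[nu]_y (expR (l * (y ^+ 2 - v)))%:E)%E.
rewrite (@ge0_integral_density R _ (measurableTypeR R) lebesgue_measure nu _
  (measurable_normal_pdf 0 (Num.sqrt v)) (normal_pdf_ge0 0 (Num.sqrt v))
  nuE _ mf (fun x => expR_ge0 _)).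
(* The tilted density is [c] times the N(0, w) density, so the integral is [c], that is exp(- l v) /
   sqrt(1 - 2 l v). *)
pose c := expR (- (l * v)) * (normal_peak (Num.sqrt v) / normal_peak (Num.sqrt w)).
have pw0 : 0 < normal_peak (Num.sqrt w) by exact: normal_peak_gt0.
have pv0 : 0 < normal_peak (Num.sqrt v) by exact: normal_peak_gt0.
have c0 : 0 <= c by rewrite mulr_ge0 ?expR_ge0// divr_ge0 ?ltW.
have pdfE y : expR (l * (y ^+ 2 - v)) * normal_pdf 0 (Num.sqrt v) y =
    c * normal_pdf 0 (Num.sqrt w) y.
  rewrite !normal_pdfE// /normal_fun !subr0 !sqr_sqrtr ?(ltW v0) ?(ltW w0)//.
  have -> : l * (y ^+ 2 - v) = - (l * v) + l * y ^+ 2 by ring.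
  have -> : - y ^+ 2 / (w *+ 2) = l * y ^+ 2 + (- y ^+ 2 / (v *+ 2)).
    exact: tilted_exponent.
  by rewrite !expRD /c; field; exact: lt0r_neq0.
under eq_integral do rewrite pdfE EFinM.
rewrite ge0_integralZl//=; last 2 first.
- by apply/measurable_EFinP; exact: measurable_normal_pdf.
- by move=> y _; rewrite lee_fin normal_pdf_ge0.
rewrite integral_normal_pdf mule1 lee_fin /c.
rewrite {1}/normal_peak /normal_peak invrK !sqr_sqrtr ?(ltW v0) ?(ltW w0)//.
rewrite -(ler_pM2l (expR_gt0 (l * v))) mulrA -expRD subrr expR0 mul1r -expRD.
rewrite ler_pdivrMl ?sqrtr_gt0 ?mulrn_wgt0 ?mulr_gt0 ?pi_gt0//.
(* Here 2 e = x + x^2; writing exp(e) as a square root leaves a comparison under the roots, which is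
   [expR_quadratic_ge]. *)
set e := l * v + _.
have e2 : expR e ^+ 2 = expR (x + x ^+ 2).
  by rewrite -expRM_natl; congr expR; rewrite /e /x; ring.
rewrite -[expR e]ger0_norm ?expR_ge0// -sqrtr_sqr e2 -sqrtrM; last first.
  by rewrite mulrn_wge0// mulr_ge0 ?pi_ge0 ?ltW.
rewrite ler_wsqrtr// -(mulr_natr (w * _)) -(mulr_natr (v * _)).
have -> : v * pi * 2 * expR (x + x ^+ 2) = (v * expR (x + x ^+ 2)) * pi * 2 by ring.
rewrite !ler_pM2r ?pi_gt0// ler_pdivrMr// -mulrA ler_peMr ?(ltW v0)//.
exact: expR_quadratic_ge.
Qed.
End normal_square.

(** * Mean squares of Gaussian linear forms *)

Section linear_forms.
Context {R : realType}.

Definition linear_form (p : nat) (u : 'cV[R]_p) (x : p.-tuple R) : R :=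
  (u^T *m cv_of_tuple x) 0 0.

Definition mean_square (n p : nat) (u : 'cV[R]_p) (x : 'I_n -> p.-tuple R) : R :=
  n%:R^-1 * \sum_(k < n) linear_form u (x k) ^+ 2.

Definition quad_form (p : nat) (S : 'M[R]_p) (u : 'cV[R]_p) : R :=
  (u^T *m S *m u) 0 0.

Lemma linear_formE (p : nat) (u : 'cV[R]_p) (x : p.-tuple R) :
  linear_form u x = \sum_(i < p) u i 0 * tnth x i.
Proof. by rewrite /linear_form mxE; apply: eq_bigr => i _; rewrite !mxE. Qed.

Lemma measurable_linear_form (p : nat) (u : 'cV[R]_p) :
  measurable_fun [set: p.-tuple R] (linear_form u).
Proof.
rewrite (_ : linear_form u = fun x => \sum_(i < p) u i 0 * tnth x i); last first.
  by apply/funext => x; rewrite linear_formE.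
by apply: measurable_sum => i; apply: measurable_funM => //; exact: measurable_tnth.
Qed.

(** A change of variables along the linear form, whose law is prescribed by [centered_gaussian]. *)
Lemma expectation_linear_form (p : nat) (S : 'M[R]_p) (d : measure_display)
    (T : measurableType d) (P : probability T R) (Y : {RV P >-> p.-tuple R})
    (u : 'cV[R]_p) (f : R -> R) :
    centered_gaussian S (distribution P Y) ->
    measurable_fun [set: measurableTypeR R] f -> (forall y, 0 <= f y) ->
  (\int[P]_w (f (linear_form u (Y w)))%:E =
   @integral _ (measurableTypeR R) R (centered_normal (quad_form S u)) setT
     (fun y : R => (f y)%:E))%E.
Proof.
move=> gY mf f0.
pose phi : T -> measurableTypeR R := fun w => linear_form u (Y w).
have mphi : measurable_fun setT phi.
  apply: (measurableT_comp (f := linear_form u)) => //.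
  exact: measurable_linear_form.
have mEf : measurable_fun [set: measurableTypeR R] (fun y => (f y)%:E).
  exact/measurable_EFinP.
have Ef0 : {in [set: measurableTypeR R], forall y, (0 <= (f y)%:E)%E}.
  by move=> y _; rewrite lee_fin.
have := ge0_integral_pushforward mphi P measurableT mEf Ef0.
rewrite preimage_setT => <-.
have nuE A : measurable A -> A `<=` [set: measurableTypeR R] ->
    pushforward P phi A = centered_normal (quad_form S u) A.
  by move=> mA _; exact: gY.
(* [centered_normal] is only a set function; each of its two branches is a measure, to which
   equality of integrals applies. *)
rewrite /centered_normal in nuE *; case: ifPn nuE => _ nuE.
  exact: (@eq_measure_integral _ (measurableTypeR R) _ setT
    (\d_(0 : measurableTypeR R)) (pushforward P phi)).
exact: (@eq_measure_integral _ (measurableTypeR R) _ setT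
  (normal_prob 0 (Num.sqrt (quad_form S u))) (pushforward P phi)).
Qed.

(** The exponential is a product over the observations with parameter l = m / n. Each factor costs
    exp(2 (m v / n)^2), and n of them give the stated exponent. *)
Lemma expectation_mean_square (n p : nat) (S : 'M[R]_p) (d : measure_display)
    (T : measurableType d) (P : probability T R) (X : 'I_n -> {RV P >-> p.-tuple R})
    (u : 'cV[R]_p) (m : R) :
    (0 < n)%N -> iid_centered_gaussian S X -> 0 <= quad_form S u ->
    `|m| * quad_form S u <= 3 / 32 * n%:R ->
  (\int[P]_w (expR (m * (mean_square u (fun k => X k w) - quad_form S u)))%:E <=
   (expR (2 * (m * quad_form S u) ^+ 2 / n%:R))%:E)%E.
Proof.
have [v vE] : exists v, v = quad_form S u by exists (quad_form S u).
rewrite -vE => n0 [iX gX] v0 mv.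
have n0' : 0 < n%:R :> R by rewrite ltr0n.
pose l := m / n%:R.
have lv : `|l| * v <= 3 / 32.
  by rewrite /l normrM normfV (ger0_norm (ltW n0')) mulrAC ler_pdivrMr.
pose g (y : R) := expR (l * (y ^+ 2 - v)).
have mg : measurable_fun [set: measurableTypeR R] g.
  apply: measurableT_comp => //; apply: measurable_funM => //.
  by apply: measurable_funB => //; exact: measurable_funX.
pose f (x : p.-tuple R) := g (linear_form u x).
have mf : measurable_fun setT f.
  apply: (measurableT_comp (f := g)) => //; exact: measurable_linear_form.
have f0 x : 0 <= f x by exact: expR_ge0.
under eq_integral => w _.
  have -> : expR (m * (mean_square u (fun k => X k w) - v)) = \prod_k f (X k w).
    rewrite /f /g -expR_sum; congr expR; rewrite -mulr_sumr sumrB sumr_const card_ord.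
    by rewrite /mean_square /l -mulr_natr; field; exact: lt0r_neq0.
  over.
apply: (le_trans (expectation_prod_le iX mf f0)).
apply: (@le_trans _ _ (\prod_(k < n) (expR (2 * (l * v) ^+ 2))%:E)%E).
  suff : (0 <= \prod_(k < n) \int[P]_w (f (X k w))%:E <=
      \prod_(k < n) (expR (2 * (l * v) ^+ 2))%:E)%E by case/andP.
  elim/big_rec2 : _ => [|k x y _ /andP[x0 xy]]; first by rewrite lexx lee_fin ler01.
  have I0 : (0 <= \int[P]_w (f (X k w))%:E)%E.
    by apply: integral_ge0 => w _; rewrite lee_fin.
  rewrite mule_ge0//= lee_pmul//.
  rewrite (expectation_linear_form u (gX k) mg (fun=> expR_ge0 _)) -vE.
  by apply: expectation_normal_square.
rewrite prodEFin lee_fin prodr_const card_ord -expRM_natl ler_expR /l le_eqVlt.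
apply/orP; left; apply/eqP; field; exact: lt0r_neq0.
Qed.
End linear_forms.

(** * Real powers *)

Section powers.
Context {R : realType}.
Implicit Types a b r q t x y : R.

Lemma expR_sub1_le y : `|expR y - 1| <= `|y| * expR `|y|.
Proof.
have [y0|y0] := leP 0 y.
  rewrite (ger0_norm y0) ger0_norm; last by rewrite subr_ge0 -expR0 ler_expR.
  have := expR_ge1Dx (- y); rewrite -(ler_pM2l (expR_gt0 y)) -expRD subrr expR0.
  by rewrite mulrDr mulr1 mulrN (mulrC (expR y)); lra.
rewrite ler0_norm ?opprB; last by rewrite subr_le0 -[leRHS]expR0 ler_expR ltW.
rewrite ltr0_norm//; have := expR_ge1Dx y => h.
have : - y * 1 <= - y * expR (- y).
  apply: ler_wpM2l; first by rewrite oppr_ge0 ltW.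
  by rewrite -expR0 ler_expR oppr_ge0 ltW.
by lra.
Qed.

Lemma norm_ln_le x : 4^-1 <= x -> `|ln x| <= 4 * `|x - 1|.
Proof.
move=> x4; have x0 : 0 < x by lra.
have [x1|x1] := leP 1 x.
  rewrite !ger0_norm ?subr_ge0 ?ln_ge0//.
  have := @le_ln1Dx _ (x - 1); rewrite addrCA subrr addr0 => h.
  have {}h : ln x <= x - 1 by apply: h; lra.
  lra.
have xi : x * x^-1 = 1 by rewrite divff ?gt_eqF.
have xi4 : x^-1 <= 4 by rewrite -[4]invrK lef_pV2 ?posrE.
have xi1 : 1 <= x^-1 by rewrite invf_ge1// ltW.
rewrite -normrN -lnV ?posrE// ger0_norm ?ln_ge0//.
have := @le_ln1Dx _ (x^-1 - 1); rewrite addrCA subrr addr0 => h.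
rewrite ltr0_norm ?subr_lt0// opprB; apply: (le_trans (h _)); first by lra.
have -> : x^-1 - 1 = x^-1 * (1 - x) by rewrite mulrBr mulr1 mulrC xi.
by rewrite ler_wpM2r// subr_ge0 ltW.
Qed.

Definition powR_lip r : R := 4 * r * expR (12 * r).

(** With y = r ln x, [expR_sub1_le] bounds the difference by |y| exp |y|. On [1/4, 4] one has |y| <=
    4 r |x - 1| and |x - 1| <= 3, which gives the two constants of [powR_lip]. *)
Lemma powR_sub1_le r x : 0 < r -> 4^-1 <= x <= 4 ->
  `|x `^ r - 1| <= powR_lip r * `|x - 1|.
Proof.
move=> r0 /andP[x1 x2]; have x0 : 0 < x by lra.
rewrite /powR gt_eqF//; apply: (le_trans (expR_sub1_le _)).
have l := norm_ln_le x1.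
rewrite normrM (ger0_norm (ltW r0)).
have x3 : `|x - 1| <= 3 by rewrite ler_norml; lra.
have h1 : r * `|ln x| <= 4 * r * `|x - 1|.
  by rewrite (mulrC 4) -mulrA ler_pM2l.
have h2 : r * `|ln x| <= 12 * r.
  by apply: (le_trans h1); rewrite mulrC mulrA -ler_pdivlMr// mulfK ?gt_eqF//; lra.
rewrite /powR_lip [leRHS]mulrAC; apply: ler_pM.
- by rewrite mulr_ge0// ltW.
- exact: expR_ge0.
- exact: h1.
- by rewrite ler_expR.
Qed.

(** By homogeneity, dividing by a reduces this to the bound near 1. *)
Lemma powR_diff_le r a b : 0 < r -> 0 < a -> 4^-1 * a <= b <= 4 * a ->
  `|b `^ r - a `^ r| <= powR_lip r * a `^ (r - 1) * `|b - a|.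
Proof.
move=> r0 a0 /andP[b1 b2]; pose x := b / a.
have x1 : 4^-1 <= x by rewrite ler_pdivlMr.
have x2 : x <= 4 by rewrite ler_pdivrMr.
have -> : b = a * x by rewrite /x mulrC divfK ?gt_eqF.
have x0 : 0 <= x by lra.
rewrite powRM ?(ltW a0)//.
have -> : a `^ r * x `^ r - a `^ r = a `^ r * (x `^ r - 1) by ring.
have -> : a * x - a = a * (x - 1) by ring.
rewrite !normrM (ger0_norm (powR_ge0 _ _)) (ger0_norm (ltW a0)).
have -> : powR_lip r * a `^ (r - 1) * (a * `|x - 1|) =
  a `^ r * (powR_lip r * `|x - 1|).
  by rewrite -(mulr_powRB1 (ltW a0) r0); ring.
by rewrite ler_wpM2l ?powR_ge0// powR_sub1_le// x1.
Qed.

(** Raise x / (K s) <= exp(x / (K s)) to the power s. *)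
Lemma powR_le_expR (K s x : R) : 0 < K -> 0 < s -> 0 <= x ->
  x `^ s <= (K * s) `^ s * expR (x / K).
Proof.
move=> K0 s0 x0; have Ks0 : 0 < K * s by rewrite mulr_gt0.
have h : x <= K * s * expR (x / (K * s)).
  rewrite mulrC -ler_pdivrMr// (le_trans _ (expR_ge1Dx _))//; lra.
have -> : expR (x / K) = expR (x / (K * s)) `^ s.
  by rewrite -expRM; congr expR; field; rewrite !gt_eqF.
rewrite -powRM ?expR_ge0 ?(ltW Ks0)//.
by apply: ge0_ler_powR; rewrite ?nnegrE ?(ltW s0)// mulr_ge0 ?expR_ge0 ?(ltW Ks0).
Qed.
End powers.

(** * Thresholding one entry *)

Section entries.
Context {R : realType}.
Implicit Types a b r q t x y tau : R.

(* Up to constants, the square of [rate_root r q tau * M] is [rate]. *)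
Definition rate_root r q tau : R :=
  if q < Num.max (r - 1) 0 then tau else tau `^ (r - q).

(** The first summand serves the entries set to 0, the second those that are kept. *)
Definition entry_lip r q : R := 2 `^ (r - q) + powR_lip r * 4 `^ (q + 1).

Lemma powR_lip_ge0 r : 0 <= r -> 0 <= powR_lip r.
Proof. by move=> r0; rewrite /powR_lip !mulr_ge0 ?expR_ge0. Qed.

Lemma abs_pow_ge0 x q : 0 <= abs_pow x q.
Proof. by rewrite /abs_pow; case: ifP => _; rewrite ?ler0n ?powR_ge0. Qed.

Lemma abs_powE x q : x != 0 -> abs_pow x q = `|x| `^ q.
Proof.
by move=> x0; rewrite /abs_pow; case: eqVneq => // ->; rewrite x0 powRr0.
Qed.

Lemma abs_pow_powR x r : 0 < r -> abs_pow x r = `|x| `^ r.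
Proof. by move=> r0; rewrite /abs_pow gt_eqF. Qed.

Lemma rate_root_ge0 r q tau : 0 <= tau -> 0 <= rate_root r q tau.
Proof. by move=> tau0; rewrite /rate_root; case: ifP => _ //; rewrite powR_ge0. Qed.

Lemma entry_lip_ge0 r q : 0 < r -> 0 <= entry_lip r q.
Proof.
move=> r0.
by rewrite /entry_lip addr_ge0 ?mulr_ge0 ?powR_ge0 ?powR_lip_ge0 ?(ltW r0).
Qed.

Lemma powR_le_rate_root r q tau : 0 <= q -> q < r -> 0 <= tau <= 1 ->
  tau `^ (r - q) <= rate_root r q tau.
Proof.
move=> q0 qr /andP[tau0 tau1]; rewrite /rate_root; case: ifPn => // h.
have [->|tn0] := eqVneq tau 0; first by rewrite powR0// subr_eq0 gt_eqF.
have tp : 0 < tau by rewrite lt_neqAle eq_sym tn0.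
rewrite -[leRHS](powRr1 tau0); apply: ger_powR; first by rewrite tp.
by move: h; rewrite lt_max [q < 0]ltNge q0 orbF; lra.
Qed.

Lemma small_entry_le r q tau x : 0 < r -> 0 <= q -> q < r -> 0 <= tau <= 1 ->
  `|x| <= 7 / 4 * tau ->
  `|x| `^ r <= 2 `^ (r - q) * (rate_root r q tau * abs_pow x q).
Proof.
(* The entry 0 is separate because [abs_pow] and the library power differ there when q = 0. *)
move=> r0 q0 qr /andP[tau0 tau1] xt; have [->|xn0] := eqVneq x 0.
  by rewrite normr0 powR0 ?gt_eqF// !mulr_ge0 ?powR_ge0 ?rate_root_ge0 ?abs_pow_ge0.
rewrite abs_powE// -[in leLHS](subrK q r) [in leLHS]powRD; last first.
  by rewrite normr_eq0 xn0 implybT.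
rewrite mulrA ler_wpM2r ?powR_ge0//.
apply: (@le_trans _ _ ((2 * tau) `^ (r - q))).
  by apply: ge0_ler_powR; rewrite ?nnegrE ?normr_ge0//; lra.
by rewrite powRM// ler_wpM2l ?powR_ge0// powR_le_rate_root// tau0.
Qed.

(** The difference is at most a constant times a^(r - 1) tau. If q < r - 1, then a <= 1 gives a^(r -
    1) <= a^q. Otherwise a^(r - 1) = a^q / a^(q + 1 - r), and a >= tau / 4 turns the denominator
    into a power of tau. *)
Lemma large_entry_le r q tau a b :
    0 < r -> 0 <= q -> q < r -> 0 <= tau <= 1 ->
    0 < a <= 1 -> tau / 4 <= a -> a / 4 <= b <= 4 * a -> `|b - a| <= tau ->
  `|b `^ r - a `^ r| <= powR_lip r * 4 `^ (q + 1) * (rate_root r q tau * a `^ q).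
Proof.
move=> r0 q0 qr /andP[tau0 tau1] /andP[a0 a1] ta /andP[b1 b2] bat.
have C0 := powR_lip_ge0 (ltW r0).
(* The threshold is 0 when p = 1; negative powers of tau are used below. *)
have [t0|tn0] := eqVneq tau 0.
  have -> : b = a.
    by apply/eqP; rewrite -subr_eq0 -normr_eq0 eq_le normr_ge0 -t0 bat.
  by rewrite subrr normr0 !mulr_ge0 ?powR_ge0 ?rate_root_ge0 ?(ltW r0).
have tp : 0 < tau by rewrite lt_neqAle eq_sym tn0.
apply: (@le_trans _ _ (powR_lip r * a `^ (r - 1) * tau)).
  apply: (@le_trans _ _ (powR_lip r * a `^ (r - 1) * `|b - a|)).
    by apply: powR_diff_le => //; rewrite mulrC b1.
  by rewrite ler_wpM2l// mulr_ge0 ?powR_ge0.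
rewrite -2!(mulrA (powR_lip r)) (ler_wpM2l C0)// /rate_root; case: ifPn => h.
  have qr1 : q <= r - 1 by move: h; rewrite lt_max; case/orP; lra.
  apply: (@le_trans _ _ (a `^ q * tau)).
    by rewrite ler_wpM2r//; apply: ger_powR => //; rewrite a0.
  have -> : 4 `^ (q + 1) * (tau * a `^ q) = a `^ q * tau * 4 `^ (q + 1) by ring.
  rewrite ler_peMr ?mulr_ge0 ?powR_ge0//.
  by rewrite -[leLHS](powRr0 4); apply: ler_powR; lra.
have rq1 : r - 1 <= q by move: h; rewrite lt_max negb_or -leNgt => /andP[].
have -> : 4 `^ (q + 1) * (tau `^ (r - q) * a `^ q) =
    a `^ q * (4 `^ (q + 1) * tau `^ (r - q)) by ring.
have an0 : a != 0 by rewrite gt_eqF.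
have -> : r - 1 = q - (q + 1 - r) by ring.
rewrite powRB ?an0 ?implybT// -mulrA ler_wpM2l ?powR_ge0//.
have t4 : 0 < tau / 4 by rewrite divr_gt0.
apply: (@le_trans _ _ (((tau / 4) `^ (q + 1 - r))^-1 * tau)).
  rewrite ler_wpM2r// lef_pV2 ?posrE ?powR_gt0//.
  by apply: ge0_ler_powR => //; rewrite ?nnegrE; lra.
rewrite powRM// invfM -powR_inv1// -powRrM mulN1r powRN invrK.
rewrite mulrAC mulrC; apply: ler_pM; rewrite ?mulr_ge0 ?invr_ge0 ?powR_ge0//.
  by apply: ler_powR; lra.
have -> : r - q = 1 - (q + 1 - r) by ring.
by rewrite (@powRB _ tau 1) ?tn0 ?implybT// powRr1// mulrC.
Qed.

(** A kept off-diagonal entry has |e| > tau, hence |s| > tau / 4; on the diagonal s = 1 and |e| >= 1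
    - 3/4. So |e| and |s| are comparable up to a factor 4. A dropped entry has |e| <= tau, hence |s|
    <= 7 tau / 4. *)
Lemma threshold_entry_le r q tau (diag : bool) (s e : R) :
    0 < r -> 0 <= q -> q < r -> 0 <= tau <= 1 ->
    `|s| <= 1 -> (diag -> s = 1) -> `|e - s| <= 3 / 4 * tau ->
  `|abs_pow (if diag || (tau < `|e|) then e else 0) r - abs_pow s r| <=
    entry_lip r q * (rate_root r q tau * abs_pow s q).
Proof.
move=> r0 q0 qr /[dup] tau01 /andP[tau0 tau1] s1 ds es; rewrite !(abs_pow_powR _ r0).
have es' : `| `|e| - `|s| | <= 3 / 4 * tau by exact: le_trans (ler_dist_dist _ _) es.
have /andP[es1 es2] : - (3 / 4 * tau) <= `|e| - `|s| <= 3 / 4 * tau.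
  by rewrite -ler_norml.
have R0 : 0 <= rate_root r q tau * abs_pow s q.
  by rewrite mulr_ge0 ?rate_root_ge0 ?abs_pow_ge0.
rewrite /entry_lip mulrDl; case: ifPn => [h|].
  apply: ler_wpDl; first by rewrite mulr_ge0 ?powR_ge0.
  have /andP[sp st] : (0 < `|s|) && (tau / 4 <= `|s|).
    move: h es1 es2; case: (diag) ds => [/(_ isT) ->|_ /= h] *.
      by rewrite normr1 ltr01; lra.
    by apply/andP; split; lra.
  have sn0 : s != 0 by rewrite -normr_gt0.
  rewrite abs_powE//; apply: large_entry_le; rewrite ?sp//; last by lra.
  move: h es1 es2; case: (diag) ds => [/(_ isT) -> _|_ /= h] h1 h2.
    by rewrite normr1 in h1 h2 *; apply/andP; split; lra.
  by apply/andP; split; lra.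
rewrite negb_or -leNgt => /andP[_ et].
apply: ler_wpDr.
  exact: mulr_ge0 (mulr_ge0 (powR_lip_ge0 (ltW r0)) (powR_ge0 _ _)) R0.
rewrite normr0 powR0 ?gt_eqF// sub0r normrN ger0_norm ?powR_ge0//.
by apply: small_entry_le; lra.
Qed.
End entries.

(** * Row sums and polarization *)

Section matrices.
Context {R : realType}.

Lemma row_sum_le_ell (r : R) (p : nat) (A : 'M[R]_p) i :
  \sum_j abs_pow (A i j) r <= ell r A.
Proof. exact: (le_bigmax_cond _ (fun i => \sum_j abs_pow (A i j) r)). Qed.

Lemma ell_le_add (r e : R) (p : nat) (A B : 'M[R]_p) : 0 <= e ->
    (forall i, \sum_j abs_pow (A i j) r <= \sum_j abs_pow (B i j) r + e) ->
  ell r A <= ell r B + e.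
Proof.
move=> e0 AB; rewrite {1}/ell; apply: bigmax_le => [|i _].
  by rewrite addr_ge0// /ell bigmax_ge_id.
by rewrite (le_trans (AB i))// lerD2r row_sum_le_ell.
Qed.

Lemma ell_ge0 (r : R) (p : nat) (A : 'M[R]_p) : 0 <= ell r A.
Proof. exact: bigmax_ge_id. Qed.

Lemma ell_dist_le (r e : R) (p : nat) (A B : 'M[R]_p) : 0 <= e ->
    (forall i, `|\sum_j abs_pow (A i j) r - \sum_j abs_pow (B i j) r| <= e) ->
  `|ell r A - ell r B| <= e.
Proof.
move=> e0 AB; rewrite ler_distl lerBlDr; apply/andP; split; apply: ell_le_add => // i.
  by have := AB i; rewrite ler_distl lerBlDr => /andP[].
by have := AB i; rewrite ler_distl => /andP[].
Qed.

Lemma ell_le_bound (r c : R) (p : nat) (A : 'M[R]_p) : 0 <= c ->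
  (forall i j, abs_pow (A i j) r <= c) -> ell r A <= p%:R * c.
Proof.
move=> c0 Ac; apply: bigmax_le => [|i _]; first by rewrite mulr_ge0.
rewrite (le_trans (ler_sum _ (fun j _ => Ac i j)))// sumr_const card_ord.
by rewrite mulr_natl.
Qed.

Definition bool_sign (b : bool) : R := (-1) ^+ b.

(** The coefficients of x_i + x_j for [false] and of x_i - x_j for [true]. For i = j and [true] this
    is the zero vector, whose form has variance 0. *)
Definition pair_vec (p : nat) (i j : 'I_p) (b : bool) : 'cV[R]_p :=
  delta_mx i 0 + bool_sign b *: delta_mx j 0.

Lemma linear_form_pair (p : nat) (i j : 'I_p) b (x : p.-tuple R) :
  linear_form (pair_vec i j b) x = tnth x i + bool_sign b * tnth x j.
Proof.
rewrite linear_formE; under eq_bigr do rewrite !mxE !eqxx !andbT mulrDl.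
rewrite big_split/= (bigD1 i)//= (bigD1 j (P := xpredT))//= !eqxx mul1r mulr1.
rewrite !big1 ?addr0// => k kn; rewrite (negbTE kn) ?mul0r//.
by rewrite mulr0 mul0r.
Qed.

Lemma empirical_cov_polar (n p : nat) (x : 'I_n -> p.-tuple R) (i j : 'I_p) :
  empirical_cov x i j =
  (mean_square (pair_vec i j false) x - mean_square (pair_vec i j true) x) / 4.
Proof.
rewrite /empirical_cov /mean_square mxE summxE -mulrBr -sumrB -mulrA; congr (_ * _).
rewrite mulr_suml; apply: eq_bigr => k _.
by rewrite !linear_form_pair /bool_sign expr0 expr1 mxE big_ord1 !mxE; field.
Qed.

Lemma quad_form_pair (p : nat) (S : 'M[R]_p) (i j : 'I_p) b : S^T = S ->
  quad_form S (pair_vec i j b) = S i i + S j j + 2 * bool_sign b * S i j.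
Proof.
move=> ST; rewrite /quad_form /pair_vec.
have -> : (delta_mx i 0 + bool_sign b *: delta_mx j 0 : 'cV[R]_p)^T =
    delta_mx 0 i + bool_sign b *: delta_mx 0 j.
  by rewrite linearD linearZ/= !trmx_delta.
rewrite !mulmxDl !mulmxDr -!scalemxAl -!scalemxAr.
have dE (k l : 'I_p) : (delta_mx 0 k *m S *m delta_mx l 0 : 'M[R]_1) 0 0 = S k l.
  by rewrite -rowE -colE !mxE.
have addE (A B : 'M[R]_1) : (A + B) 0 0 = A 0 0 + B 0 0 by rewrite mxE.
have scaleE c (A : 'M[R]_1) : (c *: A) 0 0 = c * A 0 0 by rewrite mxE.
rewrite !(addE, scaleE, dE).
have -> : S j i = S i j by rewrite -{1}ST mxE.
by rewrite /bool_sign; case: b; rewrite ?expr0 ?expr1; ring.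
Qed.

Lemma diag_class_entry (q M : R) (p : nat) (S : 'M[R]_p) i :
  sparse_class q M S -> S i i = 1.
Proof.
by move=> [_ _ /matrixP/(_ i i)]; rewrite !mxE eqxx.
Qed.

Lemma quad_form_pair_class (q M : R) (p : nat) (S : 'M[R]_p) i j b :
  sparse_class q M S -> quad_form S (pair_vec i j b) = 2 + 2 * bool_sign b * S i j.
Proof.
move=> SM; have [[ST _] _ _] := SM.
by rewrite quad_form_pair// !(diag_class_entry _ SM).
Qed.

Lemma quad_form_ge0 (p : nat) (S : 'M[R]_p) u : psd_mx S -> 0 <= quad_form S u.
Proof. by move=> [_]; exact. Qed.

(** Positivity on the two vectors [pair_vec i j b] reads 2 + 2 s >= 0 and 2 - 2 s >= 0. *)
Lemma class_entry_le1 (q M : R) (p : nat) (S : 'M[R]_p) i j :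
  sparse_class q M S -> `|S i j| <= 1.
Proof.
move=> SM; have [psd _ _] := SM; rewrite ler_norml; apply/andP; split.
  have := quad_form_ge0 (pair_vec i j false) psd.
  by rewrite (quad_form_pair_class _ _ _ SM) /bool_sign expr0; lra.
have := quad_form_ge0 (pair_vec i j true) psd.
by rewrite (quad_form_pair_class _ _ _ SM) /bool_sign expr1; lra.
Qed.

Lemma quad_form_pair_le4 (q M : R) (p : nat) (S : 'M[R]_p) i j b :
  sparse_class q M S -> quad_form S (pair_vec i j b) <= 4.
Proof.
move=> SM; rewrite (quad_form_pair_class _ _ _ SM).
have := class_entry_le1 i j SM; rewrite ler_norml => /andP[].
by rewrite /bool_sign; case: b; rewrite ?expr0 ?expr1; lra.
Qed.

Lemma mean_square_ge0 (n p : nat) (u : 'cV[R]_p) (x : 'I_n -> p.-tuple R) :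
  0 <= mean_square u x.
Proof. by rewrite mulr_ge0// sumr_ge0// => k _; rewrite sqr_ge0. Qed.

End matrices.

(** * Deterministic bounds on the plug-in error *)

Section pointwise.
Context {R : realType}.

Section error.
Variables (r q tau M : R) (n p : nat) (S : 'M[R]_p) (x : 'I_n -> p.-tuple R).

Lemma empirical_cov_dist_le i j : sparse_class q M S ->
    (forall b, `|mean_square (pair_vec i j b) x - quad_form S (pair_vec i j b)| <=
       3 / 2 * tau) ->
  `|empirical_cov x i j - S i j| <= 3 / 4 * tau.
Proof.
move=> SM good; rewrite empirical_cov_polar.
have := good false; have := good true.
rewrite !(quad_form_pair_class _ _ _ SM) /bool_sign expr0 expr1; move: (mean_square _ _) (mean_square _ _) => Q1 Q2.
rewrite !ler_norml => /andP[h1 h2] /andP[h3 h4]; apply/andP; split; lra.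
Qed.

Lemma plugin_error_le : 0 < r -> 0 <= q -> q < r -> 0 <= tau <= 1 -> 0 < M ->
    sparse_class q M S ->
    (forall i j b, `|mean_square (pair_vec i j b) x - quad_form S (pair_vec i j b)| <=
       3 / 2 * tau) ->
  `|ell r (threshold_mx tau (empirical_cov x)) - ell r S| <=
    entry_lip r q * (rate_root r q tau * M).
Proof.
move=> r0 q0 qr tau01 M0 SM good; have /andP[tau0 tau1] := tau01.
have L0 := entry_lip_ge0 q r0; have K0 := rate_root_ge0 r q tau0.
apply: ell_dist_le => [|i]; first exact: mulr_ge0 L0 (mulr_ge0 K0 (ltW M0)).
rewrite -sumrB (le_trans (ler_norm_sum _ _ _))//.
apply: (@le_trans _ _ (\sum_j entry_lip r q * (rate_root r q tau * abs_pow (S i j) q))).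
  apply: ler_sum => j _; rewrite mxE; apply: threshold_entry_le => //.
  - exact: class_entry_le1 SM.
  - by move/eqP <-; exact: diag_class_entry SM.
  - exact: empirical_cov_dist_le.
rewrite -!mulr_sumr (ler_wpM2l L0)// (ler_wpM2l K0)//.
by have [_ + _] := SM; exact/le_trans/row_sum_le_ell.
Qed.

(** The constant of [powR_le_expR] for K = 16 and s = 4 r. *)
Definition moment_cst : R := (16 * (4 * r)) `^ (4 * r).

(** Every entry of either matrix, to the power r in absolute value, is at most the fourth root [th]
    of the parenthesis. Both values of [ell] then lie between 0 and p [th]. The summand 1 takes care
    of the entries of S. *)
Lemma plugin_error_crude : 0 < r -> sparse_class q M S ->
  `|ell r (threshold_mx tau (empirical_cov x)) - ell r S| ^+ 4 <=
    p%:R ^+ 4 * (1 + moment_cst * \sum_(a : 'I_p * 'I_p * bool)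
       expR (mean_square (pair_vec a.1.1 a.1.2 a.2) x / 64)).
Proof.
move=> r0 SM; set W := 1 + _.
have W1 : 1 <= W.
  by rewrite lerDl mulr_ge0 ?powR_ge0// sumr_ge0// => a _; exact: expR_ge0.
have W0 : 0 <= W by rewrite (le_trans _ W1).
pose th := W `^ 4^-1.
have th1 : 1 <= th by rewrite -[leLHS](powRr0 W); apply: ler_powR.
have th0 : 0 <= th by rewrite (le_trans _ th1).
have thW : th ^+ 4 = W.
  by rewrite -powR_mulrn// /th -powRrM mulVf ?pnatr_eq0// powRr1.
have emp i j : `|empirical_cov x i j| `^ r <= th.
  pose y := `|empirical_cov x i j|.
  have -> : y `^ r = (y `^ (4 * r)) `^ 4^-1.
    by rewrite -powRrM mulrAC divff ?pnatr_eq0// mul1r.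
  apply: ge0_ler_powR; rewrite ?nnegrE ?powR_ge0//.
  have h : y `^ (4 * r) <= moment_cst * expR (y / 16).
    by apply: powR_le_expR; rewrite ?mulr_gt0// normr_ge0.
  apply: (le_trans h); rewrite /W -[leLHS]add0r lerD//.
  rewrite ler_wpM2l ?powR_ge0//.
  have sub b : expR (mean_square (pair_vec i j b) x / 64) <=
     \sum_(a : 'I_p * 'I_p * bool) expR (mean_square (pair_vec a.1.1 a.1.2 a.2) x / 64).
    rewrite (bigD1 (i, j, b))//= lerDl sumr_ge0// => a _; exact: expR_ge0.
  have Q0 b : 0 <= mean_square (pair_vec i j b) x by exact: mean_square_ge0.
  (* A difference of two nonnegative numbers is at most the larger one in absolute value. *)
  have [b yb] : exists b, y <= mean_square (pair_vec i j b) x / 4.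
    rewrite /y empirical_cov_polar; have := Q0 false; have := Q0 true.
    set Q1 := mean_square _ x => Q1p; set Q2 := mean_square _ x => Q2p.
    have [Q12|Q12] := leP Q1 Q2; [exists false|exists true].
      by rewrite ger0_norm -/Q2; lra.
    by rewrite ltr0_norm -/Q1; lra.
  by apply: le_trans (sub b); rewrite ler_expR; lra.
have ell1 : ell r (threshold_mx tau (empirical_cov x)) <= p%:R * th.
  apply: ell_le_bound => // i j; rewrite mxE abs_pow_powR//; case: ifP => _ //.
  by rewrite normr0 powR0 ?gt_eqF.
have ell2 : ell r S <= p%:R * th.
  apply: ell_le_bound => // i j; rewrite abs_pow_powR//.
  apply: le_trans th1; have -> : 1 = 1 `^ r :> R by rewrite powR1.
  by apply: ge0_ler_powR; rewrite ?nnegrE ?(ltW r0)//; exact: class_entry_le1 SM.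
rewrite -thW -exprMn lerXn2r ?nnegrE ?normr_ge0 ?mulr_ge0//.
have := ell_ge0 r S; have := ell_ge0 r (threshold_mx tau (empirical_cov x)).
by rewrite ler_norml => ? ?; apply/andP; split; lra.
Qed.
End error.
End pointwise.

(** * Integrating a pointwise bound *)

Section expectation.
Context {R : realType} (d : measure_display) (T : measurableType d).
Variable P : probability T R.

(** The integral is a supremum over the simple functions below the integrand, and those below f are
    below g. It is applied to the squared error, whose measurability is never established. *)
Lemma ge0_le_integral_nonmeasurable (f g : T -> \bar R) :
    (forall w, 0 <= f w)%E -> (forall w, f w <= g w)%E ->
  (\int[P]_w f w <= \int[P]_w g w)%E.
Proof.
move=> f0 fg; have g0 w : (0 <= g w)%E := le_trans (f0 w) (fg w).
rewrite !ge0_integralTE//; apply: le_ereal_sup => _ [h hf <-]; exists h => //.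
by move=> w; exact: le_trans (hf w) (fg w).
Qed.

Lemma expectation_le_sum (I : finType) (c : R) (f : T -> R) (g : I -> T -> R)
    (b : I -> R) :
    (forall w, 0 <= f w) -> 0 <= c ->
    (forall i, measurable_fun setT (g i)) -> (forall i w, 0 <= g i w) ->
    (forall w, f w <= c + \sum_i g i w) ->
    (forall i, \int[P]_w (g i w)%:E <= (b i)%:E)%E ->
  ('E_P[f] <= (c + \sum_i b i)%:E)%E.
Proof.
move=> f0 c0 mg g0 fg gb; rewrite unlock.
apply: (@le_trans _ _ (\int[P]_w (c%:E + \sum_i (g i w)%:E))%E).
  apply: ge0_le_integral_nonmeasurable => w; first by rewrite lee_fin.
  by rewrite sumEFin -EFinD lee_fin.
rewrite ge0_integralD//=; last 2 first.
- by move=> w _; rewrite sumEFin lee_fin sumr_ge0.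
- by apply: emeasurable_sum => i; exact/measurable_EFinP.
rewrite integral_cst//= probability_setT mule1 ge0_integral_sum//=; last 2 first.
- by move=> i; exact/measurable_EFinP.
- by move=> i w _; rewrite lee_fin.
by rewrite EFinD leeD2l// -sumEFin lee_sum.
Qed.
End expectation.

(** * The squared error bounded by exponentials *)

Section pointwise.
Context {R : realType}.
Variables (r q tau M K : R) (n p : nat) (S : 'M[R]_p).

(* [None] stands for the exponential that bounds the fourth moment of the error,
   [Some s] for the Chernoff exponentials of the two deviations: the exponent
   l (|Q - v| - 3 tau / 2), with l = n (3 tau / 4) / 32, minimizes
   32 l^2 / n - (3 tau / 2) l. *)
Definition tilt (o : option bool) : R :=
  if o is Some s then bool_sign s * (n%:R * (3 / 128 * tau)) else 64^-1.

(** For [Some], the weight makes the term at least K / 2 once the deviation exceeds 3 tau / 2. For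
    [None], it is the factor of the fourth-moment bound, with exp(1) paying for the centering of the
    mean square. *)
Definition tilt_weight (o : option bool) : R :=
  if o is Some _ then K / 2 * expR (- (n%:R * (9 / 256 * tau ^+ 2)))
  else p%:R ^+ 4 / (2 * K) * moment_cst r * expR 1.

Definition tilt_term (x : 'I_n -> p.-tuple R)
    (a : option bool * ('I_p * 'I_p * bool)) : R :=
  let u := pair_vec a.2.1.1 a.2.1.2 a.2.2 in
  tilt_weight a.1 * expR (tilt a.1 * (mean_square u x - quad_form S u)).

Lemma tilt_term_ge0 x a : 0 < K -> 0 <= tilt_term x a.
Proof.
move=> K0; rewrite mulr_ge0 ?expR_ge0// /tilt_weight.
by case: a.1 => [_|];
  rewrite !mulr_ge0 ?powR_ge0 ?expR_ge0 ?invr_ge0 ?mulr_ge0 ?(ltW K0).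
Qed.

Lemma plugin_error_sq_le (x : 'I_n -> p.-tuple R) :
    0 < r -> 0 <= q -> q < r -> 0 <= tau <= 1 -> 0 < M -> 0 < K ->
    sparse_class q M S ->
  (ell r (threshold_mx tau (empirical_cov x)) - ell r S) ^+ 2 <=
    (entry_lip r q * (rate_root r q tau * M)) ^+ 2 + p%:R ^+ 4 / (2 * K) +
    \sum_a tilt_term x a.
Proof.
move=> r0 q0 qr tau01 M0 K0 SM.
have /andP[tau0 tau1] := tau01.
set Z := ell r _ - _.
have [good|] := pselect (forall i j b,
    `|mean_square (pair_vec i j b) x - quad_form S (pair_vec i j b)| <= 3 / 2 * tau).
  rewrite -addrA; apply: ler_wpDr.
    rewrite addr_ge0 ?sumr_ge0 ?divr_ge0 ?exprn_ge0 ?mulr_ge0 ?(ltW K0)// => a _.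
    exact: tilt_term_ge0.
  rewrite -(real_normK (num_real Z)) ler_sqr ?nnegrE//.
    exact: plugin_error_le.
  exact: mulr_ge0 (entry_lip_ge0 q r0) (mulr_ge0 (rate_root_ge0 r q tau0) (ltW M0)).
move=> /existsNP[i /existsNP[j /existsNP[b /negP]]]; rewrite -ltNge => bad.
pose a0 := (i, j, b).
(* This is (Z^2 - K)^2 >= 0 divided by 2 K. *)
have AMGM : Z ^+ 2 <= `|Z| ^+ 4 / (2 * K) + K / 2.
  have -> : `|Z| ^+ 4 = (Z ^+ 2) ^+ 2 by rewrite -(real_normK (num_real Z)) -exprM.
  rewrite -subr_ge0.
  have -> : (Z ^+ 2) ^+ 2 / (2 * K) + K / 2 - Z ^+ 2 = (Z ^+ 2 - K) ^+ 2 / (2 * K).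
    by field; rewrite gt_eqF.
  by rewrite divr_ge0 ?sqr_ge0// mulr_ge0 ?(ltW K0).
apply: (le_trans AMGM).
have crude := plugin_error_crude tau x r0 SM.
rewrite -addrA; apply: ler_wpDl; first exact: sqr_ge0.
have -> : \sum_a tilt_term x a = \sum_o \sum_a tilt_term x (o, a).
  by rewrite pair_big; apply: eq_bigr => -[].
rewrite (bigD1 None)//= addrA; apply: lerD.
  apply: (@le_trans _ _ (p%:R ^+ 4 * (1 + moment_cst r * \sum_(a : 'I_p * 'I_p * bool)
       expR (mean_square (pair_vec a.1.1 a.1.2 a.2) x / 64)) / (2 * K))).
    by rewrite ler_wpM2r// invr_ge0 mulr_ge0 ?(ltW K0).
  rewrite mulrAC mulrDr mulr1 lerD2l.
  rewrite mulrA mulr_sumr; apply: ler_sum => -[[k l] c] _.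
  rewrite /tilt_term /= -[leRHS]mulrA ler_wpM2l//.
    by rewrite !mulr_ge0 ?powR_ge0 ?invr_ge0 ?mulr_ge0 ?(ltW K0).
  rewrite -expRD ler_expR.
  by have := quad_form_pair_le4 k l c SM; lra.
pose v := quad_form S (pair_vec i j b).
(* The sign of the deviation, so that the tilt multiplies its absolute value. At this index the
   total exponent is nonnegative, since 3/128 * 3/2 = 9/256. *)
pose s := mean_square (pair_vec i j b) x < v.
rewrite (bigD1 (Some s))//= -[leLHS]addr0; apply: lerD; last first.
  by apply: sumr_ge0 => o _; apply: sumr_ge0 => a _; exact: tilt_term_ge0.
rewrite (bigD1 a0)//= -[leLHS]addr0; apply: lerD; last first.
  by apply: sumr_ge0 => a _; exact: tilt_term_ge0.
rewrite /tilt_term/= -mulrA ler_peMr//; first by rewrite mulr_ge0 ?(ltW K0).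
rewrite -expRD -[leLHS]expR0 ler_expR -/v.
have -> : bool_sign s * (n%:R * (3 / 128 * tau)) *
    (mean_square (pair_vec i j b) x - v) =
  n%:R * (3 / 128 * tau) * `|mean_square (pair_vec i j b) x - v|.
  rewrite /s /bool_sign; case: ltP => h; rewrite ?expr1 ?expr0.
    by rewrite ltr0_norm ?subr_lt0//; ring.
  by rewrite ger0_norm ?subr_ge0//; ring.
have : n%:R * (3 / 128 * tau) * (3 / 2 * tau) <=
    n%:R * (3 / 128 * tau) * `|mean_square (pair_vec i j b) x - v|.
  by apply: ler_wpM2l; [rewrite !mulr_ge0|exact: ltW].
have -> : n%:R * (3 / 128 * tau) * (3 / 2 * tau) = n%:R * (9 / 256 * tau ^+ 2) by field.
lra.
Qed.
End pointwise.

(** * Expectation bounds *)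

Section bounds.
Context {R : realType}.

Lemma tau_threshold_sq (C0 gamma : R) (n p : nat) :
    0 <= gamma -> (0 < n)%N -> (0 < p)%N ->
  tau_threshold C0 gamma n p ^+ 2 = 4 * C0 ^+ 2 * (gamma * ln p%:R / n%:R).
Proof.
move=> g0 n0 p0; rewrite /tau_threshold exprMn sqr_sqrtr; first by ring.
by rewrite divr_ge0// mulr_ge0// ln_ge0// ler1n.
Qed.

(** One summand for each regime of [rate]; gamma appears in the first because the rate there lacks
    it. *)
Definition rate_cst (gamma C0 r q : R) : R :=
  entry_lip r q ^+ 2 * (4 * C0 ^+ 2 * gamma + (4 * C0 ^+ 2) `^ (r - q)).

Lemma rate_root_sq_le (gamma C0 r q M : R) (n p : nat) :
    0 <= gamma -> 0 <= C0 -> (0 < n)%N -> (0 < p)%N ->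
  (entry_lip r q * (rate_root r q (tau_threshold C0 gamma n p) * M)) ^+ 2 <=
    rate_cst gamma C0 r q * rate gamma r q M n p.
Proof.
move=> g0 C00 n0 p0; have lnp : 0 <= ln p%:R :> R by rewrite ln_ge0// ler1n.
have h0 : 0 <= gamma * ln p%:R / n%:R by rewrite divr_ge0// mulr_ge0.
have t0 : 0 <= tau_threshold C0 gamma n p.
  by rewrite /tau_threshold !mulr_ge0// sqrtr_ge0.
rewrite /rate_cst exprMn -mulrA ler_wpM2l ?sqr_ge0// exprMn /rate /rate_root.
case: ifP => _.
  rewrite tau_threshold_sq// [leRHS]mulrDl; apply: ler_wpDr.
    by rewrite mulr_ge0 ?powR_ge0// divr_ge0// mulr_ge0 ?sqr_ge0.
  by rewrite le_eqVlt; apply/orP; left; apply/eqP; ring.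
have -> : (tau_threshold C0 gamma n p `^ (r - q)) ^+ 2 =
    (4 * C0 ^+ 2) `^ (r - q) * (gamma * ln p%:R / n%:R) `^ (r - q).
  rewrite -powRM// ?mulr_ge0 ?sqr_ge0// -tau_threshold_sq//.
  by rewrite -(powR_mulrn 2 t0) -(powR_mulrn 2 (powR_ge0 _ _)) powRAC.
rewrite [leRHS]mulrDl; apply: ler_wpDl.
  apply: mulr_ge0; first by rewrite !mulr_ge0.
  exact: mulr_ge0 (sqr_ge0 M) (powR_ge0 _ _).
by rewrite le_eqVlt; apply/orP; left; apply/eqP; ring.
Qed.

(** This evaluates the fourth-moment weight at K = p^(2 + g / 2). *)
Lemma exp4_div_powR (x g : R) : 0 < x ->
  x ^+ 4 / (2 * x `^ (2 + g / 2)) = 2^-1 * x `^ (2 - g / 2).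
Proof.
move=> x0; rewrite -powR_mulrn ?(ltW x0)//.
have -> : 2 - g / 2 = 4 - (2 + g / 2) by field.
rewrite powRB ?(gt_eqF x0) ?implybT//; field; exact/lt0r_neq0/powR_gt0.
Qed.

Lemma measurable_mean_square (n p : nat) (u : 'cV[R]_p) (d : measure_display)
    (T : measurableType d) (P : probability T R) (X : 'I_n -> {RV P >-> p.-tuple R}) :
  measurable_fun setT (fun w => mean_square u (fun k => X k w)).
Proof.
apply: measurable_funM => //; apply: measurable_sum => k; apply: measurable_funX.
apply: (measurableT_comp (f := linear_form u)) => //.
exact: measurable_linear_form.
Qed.

Lemma measurable_tilt_term (r tau K : R) (n p : nat) (S : 'M[R]_p) (d : measure_display)
    (T : measurableType d) (P : probability T R) (X : 'I_n -> {RV P >-> p.-tuple R}) a :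
  measurable_fun setT (fun w => tilt_term r tau K S (fun k => X k w) a).
Proof.
apply: measurable_funM => //; apply: measurableT_comp => //.
apply: measurable_funM => //; apply: measurable_funB => //.
exact: measurable_mean_square.
Qed.

(** One factor exp(1) comes from [tilt_weight], the other from the moment generating function; the
    summand 1 covers the Chernoff terms. *)
Definition tail_cst (r : R) : R := moment_cst r * expR 1 ^+ 2 + 1.

Lemma expectation_tilt_term (gamma C0 r q M : R) (n p : nat) (S : 'M[R]_p)
    (d : measure_display) (T : measurableType d) (P : probability T R)
    (X : 'I_n -> {RV P >-> p.-tuple R}) a :
    0 <= gamma -> 4 <= C0 -> (0 < n)%N -> (0 < p)%N ->
    tau_threshold C0 gamma n p <= 1 -> sparse_class q M S ->
    iid_centered_gaussian S X ->
  (\int[P]_w (tilt_term r (tau_threshold C0 gamma n p) (p%:R `^ (2 + gamma / 2)) S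
      (fun k => X k w) a)%:E <= (tail_cst r / 2 * p%:R `^ (2 - gamma / 2))%:E)%E.
Proof.
move=> g0 C04 n0 p0 t1 SM iX; case: a => o [[i j] b].
have n1 : 1 <= n%:R :> R by rewrite ler1n.
have p1 : 1 <= p%:R :> R by rewrite ler1n.
have pp : 0 < p%:R :> R by rewrite ltr0n.
have lnp : 0 <= ln p%:R :> R by rewrite ln_ge0.
have powE (x : R) : p%:R `^ x = expR (x * ln p%:R).
  by rewrite /powR (gt_eqF pp).
set tau := tau_threshold C0 gamma n p in t1 *.
set K := p%:R `^ (2 + _).
have C00 : 0 <= C0 by lra.
have K0 : 0 < K by exact: powR_gt0.
have t0 : 0 <= tau.
  by rewrite /tau /tau_threshold !mulr_ge0 ?sqrtr_ge0.
have v4 := quad_form_pair_le4 i j b SM.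
have v0 : 0 <= quad_form S (pair_vec i j b).
  by have [psd _ _] := SM; exact: quad_form_ge0.
rewrite /tilt_term/=; set v := quad_form S _ in v4 v0 *.
have wt0 : 0 <= tilt_weight r tau K n p o.
  rewrite /tilt_weight; case: o => [_|].
    by rewrite mulr_ge0 ?expR_ge0// ?divr_ge0// ltW.
  by rewrite !mulr_ge0 ?powR_ge0 ?expR_ge0 ?invr_ge0 ?mulr_ge0 ?(ltW K0).
under eq_integral do rewrite EFinM.
rewrite ge0_integralZl//=; last first.
  apply/measurable_EFinP; apply: measurableT_comp => //.
  apply: measurable_funM => //; apply: measurable_funB => //.
  exact: measurable_mean_square.
(* As v <= 4 and tau <= 1, the Chernoff tilt meets the bound 3/32 exactly, since 4 * 3/128 =
   3/32. *)
have m_le : `|tilt tau n o| * v <= 3 / 32 * n%:R.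
  case: o {wt0} => [s|]; rewrite /tilt.
    rewrite normrM /bool_sign normrX normrN1 expr1n mul1r ger0_norm ?mulr_ge0//.
    have : n%:R * (3 / 128 * tau) * v <= n%:R * (3 / 128 * tau) * 4.
      by rewrite ler_wpM2l// !mulr_ge0.
    have : n%:R * tau <= n%:R * 1 by rewrite ler_wpM2l.
    lra.
  by rewrite ger0_norm ?invr_ge0//; lra.
apply: (@le_trans _ _ ((tilt_weight r tau K n p o)%:E *
    (expR (2 * (tilt tau n o * v) ^+ 2 / n%:R))%:E)%E).
  by apply: lee_wpmul2l; [rewrite lee_fin|exact: expectation_mean_square].
rewrite -EFinM lee_fin.
have v16 : v ^+ 2 <= 16.
  have -> : 16 = 4 ^+ 2 :> R by ring.
  by rewrite ler_sqr ?nnegrE.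
have nn0 : n%:R != 0 :> R by rewrite gt_eqF// ltr0n.
case: o wt0 {m_le} => [s|] /= wt0.
  apply: (@le_trans _ _ (2^-1 * p%:R `^ (2 - gamma / 2))); last first.
    rewrite ler_wpM2r ?powR_ge0// /tail_cst.
    have : 0 <= moment_cst r * expR 1 ^+ 2.
      by rewrite mulr_ge0 ?powR_ge0 ?exprn_ge0 ?expR_ge0.
    lra.
  rewrite -[leLHS]mulrA -expRD (mulrC K) -[leLHS]mulrA /K !powE -expRD.
  rewrite ler_pM2l ?invr_gt0// ler_expR.
  have -> : 2 * (bool_sign s * (n%:R * (3 / 128 * tau)) * v) ^+ 2 / n%:R =
      9 / 8192 * (n%:R * tau ^+ 2 * v ^+ 2).
    by rewrite /bool_sign; case: (s); rewrite ?expr0 ?expr1; field.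
  (* The factor 64 is 4 * 4^2, from C0 >= 4. With v^2 <= 16 the net exponent is at most - 9/512 n
     tau^2, hence at most - 9/8 gamma ln p, while - gamma ln p suffices. *)
  have ntau : 64 * (gamma * ln p%:R) <= n%:R * tau ^+ 2.
    rewrite tau_threshold_sq//.
    have -> : n%:R * (4 * C0 ^+ 2 * (gamma * ln p%:R / n%:R)) =
      4 * C0 ^+ 2 * (gamma * ln p%:R) by field.
    rewrite ler_wpM2r ?mulr_ge0//.
    have : 4 ^+ 2 <= C0 ^+ 2 by rewrite ler_sqr ?nnegrE//; lra.
    lra.
  have : n%:R * tau ^+ 2 * v ^+ 2 <= n%:R * tau ^+ 2 * 16.
    by rewrite ler_wpM2l// mulr_ge0 ?sqr_ge0.
  have : 0 <= gamma * ln p%:R by rewrite mulr_ge0.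
  lra.
(* The moment generating function is at most exp(1) because 2 (v / 64)^2 / n <= 1. *)
apply: (@le_trans _ _ (p%:R ^+ 4 / (2 * K) * moment_cst r * expR 1 * expR 1)).
  rewrite (ler_wpM2l wt0)// ler_expR ler_pdivrMr ?ltr0n// exprMn.
  have -> : 64^-1 ^+ 2 = 4096^-1 :> R by field.
  lra.
rewrite exp4_div_powR// /tail_cst.
have -> : 2^-1 * p%:R `^ (2 - gamma / 2) * moment_cst r * expR 1 * expR 1 =
  moment_cst r * expR 1 ^+ 2 / 2 * p%:R `^ (2 - gamma / 2) by ring.
by rewrite ler_wpM2r ?powR_ge0// ler_wpM2r// lerDl.
Qed.
End bounds.

Theorem theorem4p2 (R : realType) (r gamma C0 q : R)
    (hr : 0 < r) (hgamma : 8 < gamma) (hC0 : 4 <= C0)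
    (hq0 : 0 <= q) (hqr : q < r) :
  exists C5 C6 : R, 0 < C5 /\ 0 < C6 /\
    forall (n p : nat), (0 < n)%N -> (0 < p)%N ->
      gamma * ln (p%:R : R) < n%:R ->
      tau_threshold C0 gamma n p <= 1 ->
    forall (M : R), 0 < M ->
    forall (Sigma : 'M[R]_p), sparse_class q M Sigma ->
    forall (d : measure_display) (T : measurableType d) (P : probability T R)
      (X : 'I_n -> {RV P >-> p.-tuple R}),
      iid_centered_gaussian Sigma X ->
    ('E_P[ fun w : T => ((ell r (threshold_mx (tau_threshold C0 gamma n p)
                              (empirical_cov (fun k => X k w)))
                     - ell r Sigma) ^+ 2)%R ]
      <= (C5 * rate gamma r q M n p + C6 * p%:R `^ (4 - gamma / 2))%:E)%E.
Proof.
have g0 : 0 <= gamma by lra.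
have C00 : 0 <= C0 by lra.
have L0 : 0 < entry_lip r q.
  by rewrite /entry_lip ltr_pwDl ?powR_gt0// mulr_ge0 ?powR_ge0 ?powR_lip_ge0 ?(ltW hr).
have tc0 : 0 < tail_cst r.
  by rewrite /tail_cst ltr_wpDl// mulr_ge0 ?powR_ge0 ?exprn_ge0 ?expR_ge0.
(* There are 6 p^2 exponential terms, each of expectation at most [tail_cst r / 2] times p^(2 -
   gamma / 2); the extra 1 absorbs p^4 / (2 K). *)
exists (rate_cst gamma C0 r q), (3 * tail_cst r + 1); split; last split.
- rewrite /rate_cst mulr_gt0 ?exprn_gt0// ltr_wpDl ?powR_gt0 ?mulr_ge0 ?sqr_ge0//.
  by rewrite mulr_gt0// exprn_gt0//; lra.
- by rewrite addr_gt0// mulr_gt0.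
move=> n p n0 p0 _ t1 M M0 S SM d T P X iX.
have p1 : 1 <= p%:R :> R by rewrite ler1n.
have pp : 0 < p%:R :> R by rewrite ltr0n.
set tau := tau_threshold C0 gamma n p in t1 *.
have t0 : 0 <= tau by rewrite /tau /tau_threshold !mulr_ge0 ?sqrtr_ge0.
pose K : R := p%:R `^ (2 + gamma / 2).
have K0 : 0 < K by exact: powR_gt0.
pose A := (entry_lip r q * (rate_root r q tau * M)) ^+ 2.
apply: (@le_trans _ _ (A + p%:R ^+ 4 / (2 * K) +
    \sum_(a : option bool * ('I_p * 'I_p * bool))
      tail_cst r / 2 * p%:R `^ (2 - gamma / 2))%:E).
  apply: (@expectation_le_sum _ _ _ _ _ _ _
    (fun a w => tilt_term r tau K S (fun k => X k w) a)) => //.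
  - by move=> w; exact: sqr_ge0.
  - by rewrite addr_ge0 ?sqr_ge0// divr_ge0 ?exprn_ge0 ?mulr_ge0 ?(ltW K0).
  - by move=> a; exact: measurable_tilt_term.
  - by move=> a w; exact: tilt_term_ge0.
  - by move=> w; apply: plugin_error_sq_le => //; rewrite t0.
  - by move=> a; exact: expectation_tilt_term SM iX.
rewrite lee_fin -addrA lerD//; first exact: rate_root_sq_le.
have p4 : p%:R `^ (4 - gamma / 2) = p%:R ^+ 2 * p%:R `^ (2 - gamma / 2) :> R.
  rewrite -powR_mulrn ?(ltW pp)// -powRD ?(gt_eqF pp) ?implybT//.
  by congr (_ `^ _); ring.
have card : #|{: option bool * ('I_p * 'I_p * bool)}| = (3 * (p * p * 2))%N.
  by rewrite !card_prod card_option card_bool card_ord.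
rewrite sumr_const card exp4_div_powR// p4 -[X in _ + X <= _]mulr_natr !natrM.
have p2 : 1 <= p%:R ^+ 2 :> R by rewrite exprn_ege1.
have x0 : 0 <= p%:R `^ (2 - gamma / 2) :> R by exact: powR_ge0.
have : 1 * p%:R `^ (2 - gamma / 2) <= p%:R ^+ 2 * p%:R `^ (2 - gamma / 2) :> R.
  by rewrite ler_wpM2r.
lra.
Qed.
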